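(* Let $A$ be a dipole, i.e., a graph with two vertices joined by $d$ parallel normal edges (and no other edges). Then for every graph $B$, $A \triangleright B$ implies $A \longrightarrow B$.
   Context: A graph has finite vertex and edge sets; every edge is a normal edge (two distinct end-vertices, adding 1 to each degree), a loop (one vertex, adding 2 to its degree) or a semi-edge (one vertex, adding 1 to its degree); multiple loops, semi-edges and parallel edges are allowed. A graph is simple if it has no loops, semi-edges or parallel normal edges. A covering projection from $G$ to a connected graph $H$ is a pair of surjective maps $f_V:V(G)\to V(H)$, $f_E:E(G)\to E(H)$ with $f_V$ degree preserving, $f_E$ mapping semi-edges onto semi-edges and loops onto loops (normal edges may go to normal edges, loops or semi-edges), $f_E$ incidence preserving, and $f_E$ a local bijection between the edge-neighborhoods of each vertex and its image (so the preimage of a loop at $u$ is a disjoint union of cycles spanning $f_V^{-1}(u)$, the preimage of a semi-edge at $u$ consists of semi-edges and normal edges covering each vertex of $f_V^{-1}(u)$ exactly once, and the preimage of a normal edge $uv$ is a perfect matching between $f_V^{-1}(u)$ and $f_V^{-1}(v)$). $G\longrightarrow H$ means such a projection exists. $A \triangleright B$ means every simple graph covering $A$ also covers $B$. *)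

(* Defs.v *)
From HB Require Import structures.
From mathcomp Require Import all_boot.

Set Implicit Arguments.
Unset Strict Implicit.
Unset Printing Implicit Defensive.

Inductive edge_kind := Normal | Loop | Semi.

(* Edges are unoriented: each one carries its kind and its set of
   end-vertices, so parallel edges, multiple loops and multiple semi-edges
   are distinct elements of [edge] with the same [kind] and [ends]. *)
Record graph := Graph {
  vertex : finType;
  edge : finType;
  kind : edge -> edge_kind;
  ends : edge -> {set vertex};
  card_ends : forall e, #|ends e| = if kind e is Normal then 2 else 1
}.

Arguments kind {g}.
Arguments ends {g}.

(* What the edge e adds to the degree of x. *)
Definition mult (G : graph) (e : edge G) (x : vertex G) : nat :=
  if x \in ends e then (if kind e is Loop then 2 else 1) else 0.

Definition degree (G : graph) (x : vertex G) : nat :=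
  \sum_(e : edge G) mult e x.

(* The edge-neighborhood of x as a multiset (a sequence up to [perm_eq]):
   a loop at x occurs twice, once for each of its two ends. *)
Definition edge_nbhd (G : graph) (x : vertex G) : seq (edge G) :=
  flatten [seq nseq (mult e x) e | e <- enum (edge G)].

Definition simple (G : graph) : Prop :=
  (forall e : edge G, kind e = Normal) /\
  (forall e1 e2 : edge G, ends e1 = ends e2 -> e1 = e2).

Definition adjacent (G : graph) : rel (vertex G) :=
  fun x y => [exists e : edge G, (x \in ends e) && (y \in ends e)].

Definition connected (G : graph) : Prop :=
  0 < #|vertex G| /\ (forall x y : vertex G, connect (@adjacent G) x y).

Record covering_projection (G H : graph)
    (fV : vertex G -> vertex H) (fE : edge G -> edge H) : Prop := {
  cov_connected : connected H;
  cov_surjV : forall u : vertex H, exists x, fV x = u;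
  cov_surjE : forall a : edge H, exists e, fE e = a;
  cov_degree : forall x, degree (fV x) = degree x;
  cov_semi : forall e, kind e = Semi -> kind (fE e) = Semi;
  cov_loop : forall e, kind e = Loop -> kind (fE e) = Loop;
  (* The ends of [fE e] are exactly the images of the ends of e; mere
     inclusion would let both ends of e lie over one end of a normal edge. *)
  cov_incidence : forall e, ends (fE e) = fV @: ends e;
  (* Local bijection, counted with multiplicity: the edges at x over a loop
     at [fV x] are either one loop or two normal edges. *)
  cov_local : forall x, perm_eq (map fE (edge_nbhd x)) (edge_nbhd (fV x))
}.

Definition covers (G H : graph) : Prop :=
  exists (fV : vertex G -> vertex H) (fE : edge G -> edge H),
    covering_projection fV fE.

(* A \triangleright B. *)
Definition stronger (A B : graph) : Prop :=
  forall G : graph, simple G -> covers G A -> covers G B.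

(* A normal edge has two distinct ends, so with only two vertices all d edges
   are parallel. *)
Definition dipole (d : nat) (A : graph) : Prop :=
  [/\ #|vertex A| = 2, #|edge A| = d & forall e : edge A, kind e = Normal].

(* Main.v *)
(** For n >= d the dipole has a simple n-fold cover G_n, its derived graph under
distinct voltages in Z_n; its two sides have n vertices each.  Suppose that G_n
covers B, and split the fibre of each vertex w of B into its parts of sizes a_w
and b_w on the two sides.  Counting the edges over an edge of B with ends
{w, z} (w = z for loops and semi-edges) gives a_w = b_z.  Hence all fibres have
the same size and |V(B)| divides 2n; taking n = d and n = d + 1, |V(B)| divides
2.  If |V(B)| = 2, a loop or semi-edge at w would give n = a_w + b_w = 2 a_w,
which fails for the odd one of d and d + 1, so B is a dipole.  If |V(B)| = 1,
the d edges of the dipole are distributed over the d edge-ends at the only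
vertex of B. *)

Require Import Defs.
From mathcomp Require Import all_boot.
From mathcomp Require Import all_algebra zify.

Set Implicit Arguments.
Unset Strict Implicit.
Unset Printing Implicit Defensive.

Import GRing.Theory.

(** * Edge-neighborhoods as multisets *)

Lemma count_edge_nbhd (G : graph) (P : pred (edge G)) (x : vertex G) :
  count P (edge_nbhd x) = \sum_(e | P e) mult e x.
Proof.
rewrite /edge_nbhd count_flatten -map_comp sumnE big_map big_enum /=.
rewrite [RHS]big_mkcond /=; apply: eq_bigr => e _.
by rewrite count_nseq; case: (P e); rewrite ?mul1n ?mul0n.
Qed.

Lemma size_edge_nbhd (G : graph) (x : vertex G) :
  size (edge_nbhd x) = degree x.
Proof. by rewrite -count_predT count_edge_nbhd. Qed.

Lemma mem_edge_nbhd (G : graph) (a : edge G) (x : vertex G) :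
  (a \in edge_nbhd x) = (x \in ends a).
Proof.
rewrite -has_pred1 has_count count_edge_nbhd big_pred1_eq /mult.
by case: ifP => //; case: (kind a).
Qed.

(** The edge [a] occurs [mult a w] times in [edge_nbhd w], so the local bijection amounts to one
    numerical equation for each [a], the form suited to double counting. *)
Lemma local_bijectionP (G H : graph) (fE : edge G -> edge H) x w :
  perm_eq (map fE (edge_nbhd x)) (edge_nbhd w) <->
  (forall a, \sum_(e | fE e == a) mult e x = mult a w).
Proof.
split=> [/permP loc a | loc].
  by have := loc (pred1 a); rewrite count_map !count_edge_nbhd big_pred1_eq.
apply/allP => a _ /=; apply/eqP.
by rewrite count_map !count_edge_nbhd big_pred1_eq -loc.
Qed.

Lemma setT_of_card2 (T : finType) (w z : T) :
  #|T| = 2 -> w != z -> [set: T] = [set w; z].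
Proof.
move=> T2 wz; apply/esym/eqP.
by rewrite eqEcard subsetT cardsT T2 cards2 wz.
Qed.

(** * Spanning edges *)

Lemma spanning_edge_nbhd (G : graph) (x y : vertex G) :
  (forall e : edge G, ends e = setT) -> edge_nbhd x = edge_nbhd y.
Proof.
move=> sp; congr flatten; apply: eq_map => e.
by rewrite /mult sp !inE.
Qed.

Lemma dipole_ends (A : graph) d (e : edge A) : dipole d A -> ends e = setT.
Proof.
case=> V2 _ nA; apply/eqP.
by rewrite eqEcard subsetT cardsT V2 card_ends nA.
Qed.

Lemma dipole_mult (A : graph) d (e : edge A) x : dipole d A -> mult e x = 1.
Proof.
move=> dipA; rewrite /mult (dipole_ends e dipA) inE.
by case: dipA => _ _ ->.
Qed.

Lemma dipole_degree (A : graph) d (x : vertex A) : dipole d A -> degree x = d.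
Proof.
move=> dipA; rewrite /degree; under eq_bigr do rewrite (dipole_mult _ _ dipA).
by rewrite sum1_card; case: dipA.
Qed.

Lemma dipole_edge_nbhd (A : graph) d (x : vertex A) :
  dipole d A -> edge_nbhd x = enum (edge A).
Proof.
move=> dipA; rewrite /edge_nbhd -[RHS](flatten_seq1); congr flatten.
by apply: eq_map => e; rewrite (dipole_mult _ _ dipA).
Qed.

Lemma dipole_connected (A : graph) d : 0 < d -> dipole d A -> connected A.
Proof.
move=> d_gt0 dipA; case: (dipA) => V2 Ed _; split; first by rewrite V2.
move=> x y; apply: connect1.
have /card_gt0P[e _] : 0 < #|edge A| by rewrite Ed.
by apply/existsP; exists e; rewrite (dipole_ends e dipA) !inE.
Qed.

Lemma dipole_covers_spanning (A B : graph) d :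
  dipole d A -> connected B -> #|vertex B| <= 2 ->
  (forall w : vertex B, degree w = d) -> (forall a : edge B, ends a = setT) ->
  covers A B.
Proof.
move=> dipA conB V2B degB spB; case: (conB) => /card_gt0P[w0 _] _.
case: (dipA) => V2 Ed nA.
have nb_size : size (edge_nbhd w0) = d by rewrite size_edge_nbhd.
(* If [B] has a single vertex, the second vertex of [A] falls outside the list and gets the default
   [w0], as it should. *)
pose fV (x : vertex A) := nth w0 (enum (vertex B)) (enum_rank x).
have surjV w : exists x, fV x = w.
  have lt_w : index w (enum (vertex B)) < #|vertex A|.
    by rewrite V2 (leq_trans _ V2B) // cardE index_mem mem_enum.
  exists (enum_val (Ordinal lt_w)); rewrite /fV enum_valK /=.
  by rewrite nth_index // mem_enum.
have lt_rank (e : edge A) : enum_rank e < size (edge_nbhd w0).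
  by rewrite nb_size -Ed ltn_ord.
pose fE (e : edge A) := tnth (in_tuple (edge_nbhd w0)) (Ordinal (lt_rank e)).
have map_fE : map fE (enum (edge A)) = edge_nbhd w0.
  have sz : size (map fE (enum (edge A))) = d by rewrite size_map -cardE.
  case E0 : (edge_nbhd w0) => [|a0 s0].
    by apply/size0nil; rewrite sz -nb_size E0.
  rewrite -E0; apply: (@eq_from_nth _ a0) => [|i]; first by rewrite sz nb_size.
  rewrite sz => lt_id; have lt_i : i < #|edge A| by rewrite Ed.
  have -> : i = Ordinal lt_i by [].
  rewrite (nth_map (enum_val (Ordinal lt_i))) -?cardE //.
  rewrite -enum_val_nth /fE (tnth_nth a0) /=.
  by rewrite enum_valK.
exists fV, fE; split=> //.
- move=> a; have : a \in map fE (enum (edge A)).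
    by rewrite map_fE mem_edge_nbhd spB inE.
  by case/mapP => e _ ->; exists e.
- by move=> x; rewrite degB (dipole_degree x dipA).
- by move=> e; rewrite nA.
- by move=> e; rewrite nA.
- move=> e; rewrite spB (dipole_ends e dipA); apply/setP => w.
  rewrite inE; apply/esym/imsetP.
  by have [x <-] := surjV w; exists x.
- move=> x; rewrite (dipole_edge_nbhd x dipA) map_fE.
  by rewrite (spanning_edge_nbhd w0 (fV x) spB).
Qed.

(** * Lifts of the dipole *)

(** The boolean names the side of the dipole. The edge [(i, c)] is indexed by its end on side
    [false]; the voltage of [c] shifts its other end. *)
Definition edge_end (Z : finZmodType) (C : finType) (t : C -> Z)
    (b : bool) (e : Z * C) : bool * Z :=
  (b, if b then (e.1 + t e.2)%R else e.1).

Definition lift_ends (Z : finZmodType) (C : finType) (t : C -> Z) (e : Z * C) :=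
  [set edge_end t false e; edge_end t true e].

Lemma card_lift_ends (Z : finZmodType) (C : finType) (t : C -> Z) (e : Z * C) :
  #|lift_ends t e| = 2.
Proof. by rewrite cards2. Qed.

(* The derived graph of the dipole with edge set [C], all edges oriented from
   [false] to [true], under the voltage assignment [t]. *)
Definition dipole_lift (Z : finZmodType) (C : finType) (t : C -> Z) : graph :=
  @Graph (bool * Z)%type (Z * C)%type (fun=> Normal) (lift_ends t)
    (card_lift_ends t).

Lemma mem_lift_ends (Z : finZmodType) (C : finType) (t : C -> Z) e x :
  (x \in lift_ends t e) = (edge_end t x.1 e == x).
Proof.
case: x => b i; rewrite !inE /edge_end !xpair_eqE /= eqxx /=.
by case: b => /=; rewrite ?orbF // eq_sym.
Qed.

Lemma lift_mult (Z : finZmodType) (C : finType) (t : C -> Z)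
    (e : edge (dipole_lift t)) (x : vertex (dipole_lift t)) :
  mult e x = (edge_end t x.1 e == x).
Proof. by rewrite /mult /= mem_lift_ends; case: eqP. Qed.

Lemma lift_simple (Z : finZmodType) (C : finType) (t : C -> Z) :
  injective t -> simple (dipole_lift t).
Proof.
move=> inj_t; split=> // e1 e2 /= eq12.
have eqb b : edge_end t b e1 = edge_end t b e2.
  have : edge_end t b e1 \in lift_ends t e2 by rewrite -eq12 mem_lift_ends.
  by rewrite mem_lift_ends => /eqP.
case: e1 e2 eqb {eq12} => [i c] [j c'] eqb.
case: (eqb false) => /= eij; case: (eqb true) => /=.
by rewrite eij => /addrI /inj_t ->.
Qed.

Lemma sum_lift_mult (Z : finZmodType) (C : finType) (t : C -> Z) (c : C)
    (x : vertex (dipole_lift t)) :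
  \sum_(e : edge (dipole_lift t) | e.2 == c) mult e x = 1.
Proof.
(* [(i0, c)] is the only edge over [c] at [(b, j)]: on side [true] the shift by [t c] is undone. *)
case: x => b j; pose i0 := if b then (j - t c)%R else j.
rewrite (bigD1 (i0, c)) //= big1 ?addn0.
  by rewrite lift_mult /edge_end /i0 /=; case: b @i0; rewrite ?subrK eqxx.
case=> i c' /= /andP[/eqP -> ne]; rewrite lift_mult; apply/eqP.
rewrite eqb0; apply: contraNneq ne => /= -[ej].
by rewrite /i0 -ej; case: b @i0 {ej}; rewrite ?addrK.
Qed.

Lemma lift_covers (A : graph) d (Z : finZmodType) (t : edge A -> Z) :
  0 < d -> dipole d A -> covers (dipole_lift t) A.
Proof.
move=> d_gt0 dipA; have conA := dipole_connected d_gt0 dipA.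
case: (dipA) => V2 _ _.
have /card_gt1P[u [v [_ _ uv]]] : 1 < #|vertex A| by rewrite V2.
have VE := setT_of_card2 V2 uv.
pose fV (x : vertex (dipole_lift t)) := if x.1 then v else u.
pose fE : edge (dipole_lift t) -> edge A := snd.
have loc x : perm_eq (map fE (edge_nbhd x)) (edge_nbhd (fV x)).
  by apply/local_bijectionP => a; rewrite sum_lift_mult (dipole_mult _ _ dipA).
exists fV, fE; split=> //.
- move=> w; have : w \in [set u; v] by rewrite -VE inE.
  by rewrite !inE => /orP[] /eqP ->; [exists (false, 0%R) | exists (true, 0%R)].
- by move=> a; exists (0%R, a).
- by move=> x; rewrite -!size_edge_nbhd -(perm_size (loc x)) size_map.
- by move=> e; rewrite (dipole_ends _ dipA) VE /= /lift_ends imsetU1 imset_set1.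
Qed.

(** * Fibres of covers by lifts *)

(** These are the numbers a_w ([b = false]) and b_w ([b = true]). *)
Definition side_fibre (T Z : finType) (f : bool * Z -> T) b w : nat :=
  #|[pred i | f (b, i) == w]|.

Lemma sum_side_fibre (T Z : finType) (f : bool * Z -> T) b :
  \sum_w side_fibre f b w = #|Z|.
Proof.
rewrite -sum1_card (partition_big (fun i => f (b, i)) predT) //=.
by apply: eq_bigr => w _; rewrite sum1_card.
Qed.

Section LiftCovers.

Context (Z : finZmodType) (C : finType) (t : C -> Z) (B : graph)
  (fV : vertex (dipole_lift t) -> vertex B)
  (fE : edge (dipole_lift t) -> edge B)
  (cov : covering_projection fV fE).

Lemma card_edges_over b a w :
  #|[pred e | (fE e == a) && (fV (edge_end t b e) == w)]| =
  side_fibre fV b w * mult a w.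
Proof.
have inner i : fV (b, i) == w ->
  \sum_(e | fE e == a) mult e (b, i) = mult a w.
  by have /local_bijectionP loc := cov_local cov (b, i); move=> /eqP <-.
(* Double counting: each edge over [a] is counted at its unique end on side [b]. *)
transitivity (\sum_(i | fV (b, i) == w) \sum_(e | fE e == a) mult e (b, i)).
  rewrite exchange_big /= -sum1_card big_mkcondr /=.
  apply: eq_bigr => e _; under eq_bigr do rewrite lift_mult /=.
  rewrite big_mkcond /= (bigD1 (edge_end t b e).2) //= big1.
    by rewrite addn0 eqxx.
  move=> i ne; case: ifP => // _; apply/eqP; rewrite eqb0.
  by apply: contraNneq ne => ee; rewrite -[i]/((b, i).2) -ee.
by rewrite (eq_bigr _ inner) sum_nat_const.
Qed.

(** An edge over [a] has its [false] end over [w] exactly when its [true] end lies over [z]. Both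
    counts of edges thus agree, and the common multiplicity cancels. The case [w = z] covers loops
    and semi-edges. *)
Lemma side_fibre_swap (a : edge B) w z : ends a = [set w; z] ->
  side_fibre fV false w = side_fibre fV true z.
Proof.
move=> eqa.
have ma : mult a w = mult a z by rewrite /mult eqa set21 set22.
have m0 : 0 < mult a z by rewrite /mult eqa set22; case: (kind a).
apply/eqP; rewrite -(eqn_pmul2r m0) -{1}ma -!card_edges_over; apply/eqP.
apply: eq_card => e; rewrite !inE; case: (fE e =P a) => //= fEe.
have := cov_incidence cov e.
rewrite fEe eqa /= /lift_ends imsetU1 imset_set1.
set p := fV _; set q := fV _ => pq.
have [] : (p \in [set w; z]) /\ (q \in [set w; z]).
  by rewrite pq set21 set22.
have [] : (w \in [set p; q]) /\ (z \in [set p; q]).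
  by rewrite -pq set21 set22.
rewrite !inE; move: p q {pq} => p q.
by do 4![case/orP => /eqP ?]; apply/eqP/eqP; congruence.
Qed.

Lemma fibre_adjacent w z : adjacent w z ->
  side_fibre fV false w + side_fibre fV true w =
  side_fibre fV false z + side_fibre fV true z.
Proof.
case/existsP => a /andP[wa za]; have [-> // | wz] := eqVneq w z.
have eqa : ends a = [set w; z].
  apply/esym/eqP; rewrite eqEcard subUset !sub1set wa za cards2 wz card_ends.
  by case: (kind a).
rewrite (side_fibre_swap eqa) addnC; congr (_ + _).
by apply/esym/(@side_fibre_swap a); rewrite setUC.
Qed.

Lemma fibre_const w z :
  side_fibre fV false w + side_fibre fV true w =
  side_fibre fV false z + side_fibre fV true z.
Proof.
have [_ /(_ w z)/connectP[p]] := cov_connected cov.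
elim: p w => [|y p IH] w /=; first by move=> _ ->.
by case/andP=> /fibre_adjacent -> /IH; apply.
Qed.

Lemma card_fibre w :
  #|vertex B| * (side_fibre fV false w + side_fibre fV true w) = #|Z| * 2.
Proof.
rewrite -sum_nat_const (eq_bigr _ (fun z _ => fibre_const w z)) big_split /=.
by rewrite !sum_side_fibre muln2 addnn.
Qed.

Lemma odd_lift_spanning (a : edge B) :
  #|vertex B| = 2 -> odd #|Z| -> ends a = setT.
Proof.
move=> V2 oddZ; have := card_ends a.
have [kN | nN] : kind a = Normal \/ #|ends a| = 1.
- by rewrite card_ends; case: (kind a); [left | right | right].
- by rewrite kN => a2; apply/eqP; rewrite eqEcard subsetT cardsT V2 a2.
move=> _; have /eqP/cards1P[w aw] := nN.
have eqw : side_fibre fV false w = side_fibre fV true w.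
  by apply: (@side_fibre_swap a); rewrite setUid.
(* Now 2 * (2 * a_w) = 2 * #|Z|, so #|Z| would be even. *)
have := card_fibre w; rewrite V2 eqw; lia.
Qed.

End LiftCovers.

(** * Cyclic voltages and the structure of [B] *)

Lemma cyclic_lift_covers (A B : graph) d m :
  0 < d -> dipole d A -> stronger A B -> d <= m.+1 ->
  exists t : edge A -> 'I_m.+1, covers (dipole_lift t) B.
Proof.
move=> d_gt0 dipA AB le_dm; case: (dipA) => _ Ed _.
(* The voltages are the ranks 0, ..., d - 1, distinct in Z_(m+1) because [d <= m.+1]. *)
exists (fun e => inord (enum_rank e)).
apply: AB (lift_covers _ d_gt0 dipA); apply: lift_simple => e1 e2 /(congr1 val).
rewrite /= !inordK; try by rewrite (leq_trans (ltn_ord _)) ?Ed.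
by move/val_inj/enum_rank_inj.
Qed.

Theorem theorem3 (A : graph) (d : nat) (d_gt0 : 0 < d) (dipA : dipole d A)
  (B : graph) : stronger A B -> covers A B.
Proof.
(* With [d] replaced by [d.+1], the two lifts have cyclic groups of orders [d.+1] and [d.+2]. *)
move=> AB; case: d d_gt0 dipA => // d d_gt0 dipA.
have [t1 [fV1 [fE1 cov1]]] := cyclic_lift_covers d_gt0 dipA AB (leqnn _).
have [t2 [fV2 [fE2 cov2]]] := cyclic_lift_covers d_gt0 dipA AB (leqnSn _).
have conB := cov_connected cov1; case: (conB) => V_gt0 _.
have /card_gt0P[w0 _] := V_gt0.
have le2 : #|vertex B| <= 2.
  (* 2 is the difference of the vertex numbers of the two lifts, both multiples of #|vertex B|. *)
  have : #|vertex B| %| 2.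
    rewrite -(@dvdn_addr (d.+1 * 2)).
      rewrite -mulSnr -(card_ord d.+2) -(card_fibre cov2 w0); exact: dvdn_mulr.
    rewrite -{1}(card_ord d.+1) -(card_fibre cov1 w0); exact: dvdn_mulr.
  exact: dvdn_leq.
apply: (dipole_covers_spanning dipA conB le2).
(* Degrees pass from [A] up to the lift and down to [B]. *)
- move=> w; have [x <-] := cov_surjV cov1 w.
  have [gV [gE covA]] := lift_covers t1 d_gt0 dipA.
  by rewrite (cov_degree cov1) -(cov_degree covA) (dipole_degree _ dipA).
- move=> a; have [V2 | V1] : #|vertex B| = 2 \/ #|vertex B| = 1.
  + lia.
  (* Whichever lift has a group of odd order is used. *)
  + case: (boolP (odd d.+1)) => odd_d.
      by apply: (odd_lift_spanning cov1); rewrite ?card_ord.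
    by apply: (odd_lift_spanning cov2); rewrite ?card_ord //= in odd_d *.
  + apply/eqP; rewrite eqEcard subsetT cardsT V1 card_ends.
    by case: (kind a).
Qed.
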